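(* Let the strong ignorability assumption be: $(Y^0,Y^1)\perp\!\!\!\perp A\mid X$ and $0<e(x)<1$ for all $x$. The semiparametric efficiency bound of $\beta$ under strong ignorability and monotonicity ($Y^0\le Y^1$), namely $\mathbb{E}[\phi_\beta^2]$ with $$\phi_\beta=\frac{1-\beta}{\mu_1}AY-\frac{e(X)}{\mu_1}\frac{1-A}{1-e(X)}(Y-\mu_0(X))-\frac{\mu_0(X)}{\mu_1}A,$$ is larger than the semiparametric efficiency bound of $\beta$ under strong ignorability and conditional independence ($Y^0\perp\!\!\!\perp Y^1\mid X$), namely $\mathbb{E}[\varphi_\beta^2]$ with $$\varphi_\beta=A\,\frac{1-\beta-\mu_0(X)}{\mu_1}Y-\frac{e(X)}{\mu_1}\frac{1-A}{1-e(X)}(Y-\mu_0(X))\mu_1(X).$$ The magnitude of this difference is $$\mathbb{E}[\phi_\beta^2]-\mathbb{E}[\varphi_\beta^2]=\mathbb{E}\left[\frac{A\mu_0^2(X)}{\mu_1^2}(1-Y^2)+\frac{(1-A)e^2(X)}{\mu_1^2(1-e(X))^2}(Y-\mu_0(X))^2(1-\mu_1^2(X))\right].$$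
   Context: Setting: $X$ is a $p$-dimensional covariate vector, $A\in\{0,1\}$ a binary cause, $Y\in\{0,1\}$ a binary outcome, $Y^0,Y^1\in\{0,1\}$ the potential outcomes, with $Y=AY^1+(1-A)Y^0$. The propensity score is $e(x)=\mathbb{P}(A=1\mid X=x)$; the outcome regressions are $\mu_a(x)=\mathbb{P}(Y=1\mid X=x,A=a)$, $a=0,1$. Constants: $\mu_a=\mathbb{E}[\mu_a(X)e(X)]$ for $a=0,1$. The probability of necessary causation is $\beta=\mathbb{P}(Y^0=0\mid A=1,Y=1)$, where $\mathbb{P}(A=1,Y=1)>0$; the same number $\beta$ appears in both $\phi_\beta$ and $\varphi_\beta$. The functions $\phi_\beta$ and $\varphi_\beta$ are the efficient influence functions of $\beta$ (propensity score unknown) under the two respective sets of assumptions, and the efficiency bounds are their second moments. *)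

(* Defs.v *)
From HB Require Import structures.
From mathcomp Require Import all_boot all_order all_algebra.
From mathcomp Require Import all_classical all_reals all_analysis.

Set Implicit Arguments.
Unset Strict Implicit.
Unset Printing Implicit Defensive.

Import Order.TTheory GRing.Theory Num.Theory.
Import numFieldNormedType.Exports.

Local Open Scope classical_set_scope.
Local Open Scope ring_scope.

Section conditioning_on_covariates.
Context d (Omega : measurableType d) (R : realType) (P : probability Omega R).
Context dX (TX : measurableType dX) (X : Omega -> TX).

(* [f] is a version of x |-> P(E | X = x, D): it is characterised by
   E[f(X); D, X \in B] = P(E, D, X \in B) for all measurable B, and determined
   up to a null set of the law of X given D.  Taking [D = setT] yields
   x |-> P(E | X = x). *)
Definition is_cond_prob (D E : set Omega) (f : TX -> R) : Prop :=
  measurable_fun [set: TX] f /\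
  forall B : set TX, measurable B ->
    (\int[P]_(w in D `&` X @^-1` B) (f (X w))%:E = P (E `&` D `&` X @^-1` B))%E.

(* U and V are independent given X: P(U \in B | X) P(V \in C | X) is a version
   of P(U \in B, V \in C | X).  The choice of the versions f, g is immaterial. *)
Definition cond_indep d1 d2 (T1 : measurableType d1) (T2 : measurableType d2)
    (U : Omega -> T1) (V : Omega -> T2) : Prop :=
  forall (B : set T1) (C : set T2), measurable B -> measurable C ->
  forall f g : TX -> R,
    is_cond_prob setT (U @^-1` B) f -> is_cond_prob setT (V @^-1` C) g ->
    is_cond_prob setT (U @^-1` B `&` V @^-1` C) (f \* g).

Definition is_propensity_score (A : Omega -> bool) (e : TX -> R) : Prop :=
  is_cond_prob setT [set w | A w] e.

(* [mu a x] is P(Y = 1 | X = x, A = a), with [true], [false] for 1, 0. *)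
Definition is_outcome_regression (A Y : Omega -> bool)
    (mu : bool -> TX -> R) : Prop :=
  forall a : bool, is_cond_prob [set w | A w = a] [set w | Y w] (mu a).

Definition strong_ignorability (A Y0 Y1 : Omega -> bool) (e : TX -> R) : Prop :=
  cond_indep (fun w => (Y0 w, Y1 w)) A /\ (forall x, 0 < e x < 1).

End conditioning_on_covariates.

Section necessary_causation.
Context d (Omega : measurableType d) (R : realType) (P : probability Omega R).

Definition consistency (A Y Y0 Y1 : Omega -> bool) : Prop :=
  forall w, (Y w)%:R = (A w)%:R * (Y1 w)%:R + (1 - (A w)%:R) * (Y0 w)%:R :> R.

Definition cond_pr (E D : set Omega) : R := fine (P (E `&` D)) / fine (P D).

Definition prob_necessary_causation (A Y Y0 : Omega -> bool) : R :=
  cond_pr [set w | ~~ Y0 w] [set w | A w && Y w].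

Context dX (TX : measurableType dX) (X : Omega -> TX).
Variables (A Y : Omega -> bool) (e : TX -> R) (mu : bool -> TX -> R).

Definition mean_mu (a : bool) : R :=
  fine 'E_P[(fun w => mu a (X w) * e (X w))%R]%E.

(* The efficient influence function of beta under strong ignorability and
   monotonicity Y0 <= Y1. *)
Definition phi_monotonicity (beta : R) (w : Omega) : R :=
  (1 - beta) / mean_mu true * (A w)%:R * (Y w)%:R
  - e (X w) / mean_mu true * ((1 - (A w)%:R) / (1 - e (X w)))
      * ((Y w)%:R - mu false (X w))
  - mu false (X w) / mean_mu true * (A w)%:R.

(* The efficient influence function of beta under strong ignorability and
   conditional independence of Y0 and Y1 given X. *)
Definition phi_independence (beta : R) (w : Omega) : R :=
  (A w)%:R * ((1 - beta - mu false (X w)) / mean_mu true) * (Y w)%:R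
  - e (X w) / mean_mu true * ((1 - (A w)%:R) / (1 - e (X w)))
      * ((Y w)%:R - mu false (X w)) * mu true (X w).

(* The efficiency bound attached to an efficient influence function; it may be
   infinite, as e is not assumed to be bounded away from 1. *)
Definition efficiency_bound (phi : Omega -> R) : \bar R :=
  'E_P[(fun w => phi w ^+ 2)%R]%E.

Definition bound_gap (w : Omega) : R :=
  (A w)%:R * mu false (X w) ^+ 2 / mean_mu true ^+ 2 * (1 - (Y w)%:R ^+ 2)
  + (1 - (A w)%:R) * e (X w) ^+ 2 / (mean_mu true ^+ 2 * (1 - e (X w)) ^+ 2)
      * ((Y w)%:R - mu false (X w)) ^+ 2 * (1 - mu true (X w) ^+ 2).

End necessary_causation.

(* Main.v *)
(* The squares of the two influence functions differ pointwise by [bound_gap].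
   The gap is almost surely nonnegative because the version [mu true] of
   P(Y = 1 | X, A = 1) takes its values in [0, 1] almost surely given [A = 1],
   hence, as the propensity score is positive, almost surely. The gap thus
   integrates to a nonnegative, possibly infinite, amount. *)

Require Import Defs.
From HB Require Import structures.
From mathcomp Require Import all_boot all_order all_algebra.
From mathcomp Require Import all_classical all_reals all_analysis.
From mathcomp Require Import measurable_realfun ring.

Set Implicit Arguments.
Unset Strict Implicit.
Unset Printing Implicit Defensive.

Import Order.TTheory GRing.Theory Num.Theory.
Import numFieldNormedType.Exports.

Local Open Scope classical_set_scope.
Local Open Scope ring_scope.

Lemma measurable_natr_bool (R : realType) :
  measurable_fun [set: bool] (fun b : bool => b%:R : R).
Proof. by []. Qed.

(** Inversion is continuous away from 0, and on the singleton of 0 measurability is automatic. This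
    serves to make the weight [1 / (1 - e (X w))] measurable. *)
Lemma measurable_invr (R : realType) :
  measurable_fun [set: R] (@GRing.inv R).
Proof.
have mC : measurable (~` [set (0 : R)]) by exact: measurableC.
rewrite -(setUv [set (0 : R)]).
apply/measurable_funU => //; split; first exact: measurable_fun_set1.
apply: open_continuous_measurable_fun.
  exact/closed_openC/closed_eq.
by move=> x; rewrite inE /= => /eqP x0; exact: inv_continuous.
Qed.

Lemma measurable_ltr_cst d (T : measurableType d) (R : realType) (c : R)
    (f : T -> R) :
  measurable_fun [set: T] f -> measurable [set x | f x < c].
Proof.
move=> mf; rewrite -[X in measurable X]setTI.
rewrite (_ : [set _ | _] = f @^-1` `]-oo, c[); first exact: mf.
by apply/seteqP; split => x /=; rewrite in_itv.
Qed.

Lemma measurable_gtr_cst d (T : measurableType d) (R : realType) (c : R)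
    (f : T -> R) :
  measurable_fun [set: T] f -> measurable [set x | c < f x].
Proof.
move=> mf; rewrite -[X in measurable X]setTI.
rewrite (_ : [set _ | _] = f @^-1` `]c, +oo[); first exact: mf.
by apply/seteqP; split => x /=; rewrite in_itv/= andbT.
Qed.

(** The integral of the positive function [g] is then 0, so [g] vanishes almost everywhere on [D];
    as it vanishes nowhere there, all of [D] is exceptional. *)
Lemma integral_gt0_null d (T : measurableType d) (R : realType)
    (P : {measure set T -> \bar R}) (D : set T) (g : T -> R) :
  measurable D -> measurable_fun D g -> (forall x, D x -> 0 < g x) ->
  (\int[P]_(x in D) (g x)%:E <= 0)%E -> P D = 0%E.
Proof.
move=> mD mg g_gt0 int_le0.
have mgE : measurable_fun D (EFin \o g) by exact/measurable_EFinP.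
have /(ae_eq_integral_abs P mD mgE) g0 :
    (\int[P]_(x in D) `|(EFin \o g) x| = 0)%E.
  apply/eqP; rewrite eq_le integral_ge0 ?andbT//.
  rewrite (eq_integral (EFin \o g))// => x /[!inE] Dx /=.
  by rewrite gtr0_norm// g_gt0.
apply/(negligibleP P mD); apply: negligibleS g0 => x Dx /= /(_ Dx)[] gx0.
by have := g_gt0 _ Dx; rewrite gx0 ltxx.
Qed.

Section conditional_probabilities.
Context d (Omega : measurableType d) (R : realType) (P : probability Omega R).
Context dX (TX : measurableType dX) (X : Omega -> TX).
Hypothesis mX : measurable_fun [set: Omega] X.

Let mpre (B : set TX) : measurable B -> measurable (X @^-1` B).
Proof. by move=> mB; rewrite -[X @^-1` B]setTI; exact: mX. Qed.

(** Over this event the integral of [f (X w)] is the probability of a part of the event, so the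
    excess [f (X w) - 1], positive there, has integral at most 0. *)
Lemma cond_prob_le1_null (D E : set Omega) (f : TX -> R) :
  measurable D -> measurable E -> is_cond_prob P X D E f ->
  P (D `&` X @^-1` [set x | 1 < f x]) = 0%E.
Proof.
move=> mD mE [mf fE].
set B := [set x | _].
have mB : measurable B by exact: measurable_gtr_cst.
set S := D `&` _.
have mS : measurable S by apply: measurableI => //; exact: mpre.
have mfX : measurable_fun S (f \o X).
  by apply: measurable_funTS; exact: measurableT_comp.
apply: (@integral_gt0_null _ _ _ P S (fun w => f (X w) - 1)) => //.
- exact: measurable_funB.
- by move=> x [_ /=]; rewrite subr_gt0.
(* Both [f (X w) - 1] and the constant 1 are nonnegative on [S], so the integral splits by
   additivity for nonnegative functions; the finite [P S] is cancelled afterwards. *)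
- have int_fX : (\int[P]_(w in S) (f (X w))%:E =
      \int[P]_(w in S) (f (X w) - 1)%:E + P S)%E.
    rewrite -[P S]mul1e -(integral_cst P mS 1%E) -ge0_integralD//.
    + by apply: eq_integral => x _; rewrite -EFinD subrK.
    + by move=> x [_ /= /ltW]; rewrite lee_fin subr_ge0.
    + by apply/measurable_EFinP; exact: measurable_funB.
  have : (\int[P]_(w in S) (f (X w))%:E <= P S)%E.
    rewrite fE// -setIA; apply: le_measure; rewrite ?inE//.
    exact: measurableI.
  rewrite int_fX -[leRHS]add0e leeD2rE//.
  exact: fin_num_measure.
Qed.

(** Over this event the integral of [f (X w)] is a probability, hence nonnegative, although the
    integrand is negative there. *)
Lemma cond_prob_ge0_null (D E : set Omega) (f : TX -> R) :
  measurable D -> is_cond_prob P X D E f ->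
  P (D `&` X @^-1` [set x | f x < 0]) = 0%E.
Proof.
move=> mD [mf fE].
set B := [set x | _].
have mB : measurable B by exact: measurable_ltr_cst.
set S := D `&` _.
have mS : measurable S by apply: measurableI => //; exact: mpre.
have mfX : measurable_fun S (f \o X).
  by apply: measurable_funTS; exact: measurableT_comp.
apply: (@integral_gt0_null _ _ _ P S (fun w => - f (X w))) => //.
- exact: measurableT_comp.
- by move=> x [_ /=]; rewrite oppr_gt0.
- rewrite -oppe_ge0 -integral_ge0N.
    under eq_integral do rewrite -EFinN opprK.
    by rewrite fE.
  by move=> x [_ /= /ltW]; rewrite lee_fin oppr_ge0.
Qed.

(* This is where overlap is used: a set of covariate values that is null given
   [E] is null outright. *)
Lemma cond_prob_gt0_null (E : set Omega) (f : TX -> R) (B : set TX) :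
  is_cond_prob P X setT E f -> (forall x, 0 < f x) -> measurable B ->
  P (E `&` X @^-1` B) = 0%E -> P (X @^-1` B) = 0%E.
Proof.
move=> [mf fE] f_gt0 mB PEB0.
apply: (@integral_gt0_null _ _ _ P _ (f \o X)) => //.
- exact: mpre.
- by apply: measurable_funTS; exact: measurableT_comp.
- by move=> x _; exact: f_gt0.
- by have := fE _ mB; rewrite setTI setIT PEB0 => /= ->.
Qed.

(** The bound is put on the absolute value because that is what decides the sign of
    [1 - mu true (X w) ^+ 2] in [bound_gap]. *)
Lemma outcome_regression_le1 (A Y : Omega -> bool) (e : TX -> R)
    (mu : bool -> TX -> R) :
  measurable_fun [set: Omega] A -> measurable_fun [set: Omega] Y ->
  is_propensity_score P X A e -> is_outcome_regression P X A Y mu ->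
  (forall x, 0 < e x) ->
  {ae P, forall w, `|mu true (X w)| <= 1}.
Proof.
move=> mA mY Ae muE e_gt0.
have mb (U : Omega -> bool) : measurable_fun [set: Omega] U ->
    measurable [set w | U w].
  by move=> mU; rewrite -[X in measurable X]setTI; exact: mU.
have [mmu _] := muE true.
have mlt0 := measurable_ltr_cst 0 mmu.
have mgt1 := measurable_gtr_cst 1 mmu.
have lt0 := cond_prob_gt0_null Ae e_gt0 mlt0
  (cond_prob_ge0_null (mb _ mA) (muE true)).
have gt1 := cond_prob_gt0_null Ae e_gt0 mgt1
  (cond_prob_le1_null (mb _ mA) (mb _ mY) (muE true)).
have := negligibleU (proj2 (negligibleP P (mpre mlt0)) lt0)
  (proj2 (negligibleP P (mpre mgt1)) gt1).
(* If the bound fails, either [mu true (X w)] exceeds 1 or its opposite does; the second case lies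
   in the null set where [mu true] is negative. *)
apply: negligibleS => w /= /negP; rewrite -ltNge ltr_normr => /orP[?|H].
  by right.
by left => /=; rewrite -oppr_gt0 (lt_trans ltr01).
Qed.

End conditional_probabilities.

Section influence_functions.
Context d (Omega : measurableType d) (R : realType) (P : probability Omega R).
Context dX (TX : measurableType dX) (X : Omega -> TX).
Variables (A Y : Omega -> bool) (e : TX -> R) (mu : bool -> TX -> R).

(* Each influence function is a term carrying [A] plus a term carrying [1 - A],
   so squaring creates no cross term and the identity holds pointwise, before
   taking expectations. *)
Lemma sqr_phi_monotonicity (beta : R) (w : Omega) :
  phi_monotonicity P X A Y e mu beta w ^+ 2 =
  phi_independence P X A Y e mu beta w ^+ 2 + bound_gap P X A Y e mu w.
Proof.
rewrite /phi_monotonicity /phi_independence /bound_gap.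
(* Inverses of squares become squares of inverses, so both sides are polynomials in the inverses of
   [mean_mu true] and [1 - e (X w)]. *)
rewrite [(_ ^+ 2 * _)^-1]invfM -!exprVn.
by case: (A w); case: (Y w) => /=; ring.
Qed.

(** All factors are squares or take the values 0 and 1, except [1 - mu true (X w) ^+ 2], whose sign
    comes from the hypothesis. *)
Lemma bound_gap_ge0 (w : Omega) :
  `|mu true (X w)| <= 1 -> 0 <= bound_gap P X A Y e mu w.
Proof.
move=> mu_le1.
have bool_ge0 (b : bool) : 0 <= 1 - b%:R :> R.
  by case: b; rewrite ?subrr ?subr0.
apply: addr_ge0; apply: mulr_ge0.
- by rewrite divr_ge0 ?sqr_ge0// mulr_ge0 ?sqr_ge0 ?ler0n.
- by rewrite -natrX -mulnn mulnb bool_ge0.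
- rewrite -exprMn.
  apply: mulr_ge0; rewrite ?sqr_ge0// divr_ge0 ?sqr_ge0//.
  by apply: mulr_ge0; rewrite ?bool_ge0 ?sqr_ge0.
- by rewrite subr_ge0 -real_normK ?num_real// expr_le1.
Qed.

Hypotheses (mX : measurable_fun [set: Omega] X)
  (mA : measurable_fun [set: Omega] A) (mY : measurable_fun [set: Omega] Y)
  (me : measurable_fun [set: TX] e)
  (mmu : forall a, measurable_fun [set: TX] (mu a)).

Let mAR : measurable_fun [set: Omega] (fun w => (A w)%:R : R).
Proof. exact: (measurableT_comp (@measurable_natr_bool R)). Qed.

Let mYR : measurable_fun [set: Omega] (fun w => (Y w)%:R : R).
Proof. exact: (measurableT_comp (@measurable_natr_bool R)). Qed.

Let meX : measurable_fun [set: Omega] (e \o X).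
Proof. exact: measurableT_comp. Qed.

Let mmuX a : measurable_fun [set: Omega] (mu a \o X).
Proof. exact: measurableT_comp. Qed.

Ltac measurability_arith := repeat first
  [ exact: mAR | exact: mYR | exact: meX | exact: mmuX | exact: measurable_cst
  | apply: measurable_funB | apply: measurable_funD | apply: measurable_funM
  | apply: measurable_funX
  | apply: (measurableT_comp (@measurable_invr R)) ].

Lemma measurable_phi_independence (beta : R) :
  measurable_fun [set: Omega] (phi_independence P X A Y e mu beta).
Proof. by rewrite /phi_independence; measurability_arith. Qed.

Lemma measurable_bound_gap :
  measurable_fun [set: Omega] (bound_gap P X A Y e mu).
Proof. by rewrite /bound_gap; measurability_arith. Qed.

End influence_functions.

Theorem corollary1 (d : measure_display) (Omega : measurableType d)
  (R : realType) (P : probability Omega R) (p : nat)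
  (X : {RV P >-> p.-tuple R}) (A Y Y0 Y1 : {RV P >-> bool})
  (e : p.-tuple R -> R) (mu : bool -> p.-tuple R -> R) :
  consistency R A Y Y0 Y1 ->
  is_propensity_score P X A e ->
  is_outcome_regression P X A Y mu ->
  strong_ignorability P X A Y0 Y1 e ->
  (0 < P [set w | A w && Y w])%E ->
  let beta := prob_necessary_causation P A Y Y0 in
  let bound_mono := efficiency_bound P (phi_monotonicity P X A Y e mu beta) in
  let bound_indep := efficiency_bound P (phi_independence P X A Y e mu beta) in
  (bound_indep <= bound_mono)%E /\
  ((bound_indep < +oo)%E ->
     (bound_mono - bound_indep = 'E_P[bound_gap P X A Y e mu])%E).
Proof.
move=> _ Ae muE [_ e01] _ beta bound_mono bound_indep.
have e_gt0 x : 0 < e x by have /andP[] := e01 x.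
have mX : measurable_fun [set: Omega] X by [].
have mA : measurable_fun [set: Omega] A by [].
have mY : measurable_fun [set: Omega] Y by [].
have mmu a : measurable_fun [set: p.-tuple R] (mu a) := proj1 (muE a).
set gap := bound_gap P X A Y e mu.
have mgap : measurable_fun [set: Omega] gap.
  exact: (measurable_bound_gap _ mX mA mY (proj1 Ae) mmu).
(* [gap] is nonnegative only almost surely, whereas additivity of possibly infinite integrals is
   applied to pointwise nonnegative integrands; its absolute value stands in for it. *)
have gap_norm : ae_eq P setT (EFin \o gap) (fun w => `|(gap w)%:E|)%E.
  apply: filterS (outcome_regression_le1 mX mA mY Ae muE e_gt0) => w mu_le1 _.
  by rewrite /= ger0_norm// bound_gap_ge0.
have mabs : measurable_fun [set: Omega] (fun w => `|(gap w)%:E|)%E.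
  by apply: measurableT_comp => //; exact/measurable_EFinP.
have gap_eq : 'E_P[gap]%E = (\int[P]_w `|(gap w)%:E|)%E.
  rewrite unlock; apply: ae_eq_integral gap_norm => //.
  exact/measurable_EFinP.
(* This additive form holds in the extended reals, finite or not, and both claims are read off from
   it. *)
have mono_eq : (bound_mono = bound_indep + 'E_P[gap])%E.
  rewrite gap_eq /bound_mono /bound_indep /efficiency_bound unlock.
  have mindep : measurable_fun [set: Omega] (fun w =>
      phi_independence P X A Y e mu beta w ^+ 2).
    apply: measurable_funX.
    exact: (measurable_phi_independence _ mX mA mY (proj1 Ae) mmu).
  rewrite -ge0_integralD//; first last.
  - exact/measurable_EFinP.
  - by move=> w _; rewrite lee_fin sqr_ge0.
  apply: ae_eq_integral => //.
  - apply/measurable_EFinP.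
    under eq_fun do rewrite sqr_phi_monotonicity.
    exact: measurable_funD.
  - by apply: emeasurable_funD => //; exact/measurable_EFinP.
  - apply: filterS gap_norm => w /(_ I) <-.
    by rewrite sqr_phi_monotonicity.
rewrite mono_eq; split.
  by rewrite leeDl// gap_eq integral_ge0.
(* Finiteness of [bound_indep] lets it cancel, since [+oo - +oo] is not 0; ['E_P[gap]] itself may be
   infinite. *)
move=> indep_fin; rewrite addeAC subee ?add0e//.
rewrite ge0_fin_numE// /bound_indep /efficiency_bound expectation_ge0// => w.
exact: sqr_ge0.
Qed.
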